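(* Let $n \geq 2$ be an integer, and let $Q$ be the $(n-1)\times(n-1)$ diagonal matrix $$Q = \operatorname{diag}\left[1, 3, \ldots, \frac{n(n-1)}{2}\right],$$ whose $k$-th diagonal entry is $\frac{k(k+1)}{2}$ for $1 \le k \le n-1$. Then the group $N_2(n)$ of normalized solutions (with matrix multiplication as group operation) satisfies $$N_2(n) \simeq O_{n-1}(Q,\mathbb{Q})$$ as groups.
   Context: For matrices $A=(a_{ij}), B=(b_{ij}) \in M_n(\mathbb{Q})$, write $[A]=_2^n[B]$ if the columns of $A$ and the columns of $B$, viewed as two (not necessarily disjoint) multisets of $n$ points of $\mathbb{Q}^n$, form a solution of the $n$-dimensional Prouhet--Tarry--Escott problem of degree $2$ and size $n$; that is, for all nonnegative integers $k_1,\ldots,k_n$ with $1 \le k_1+\cdots+k_n \le 2$, $$\sum_{j=1}^n a_{1j}^{k_1}\cdots a_{nj}^{k_n} = \sum_{j=1}^n b_{1j}^{k_1}\cdots b_{nj}^{k_n}.$$ Define $$N_2(n) = \{ A^{-1}B \in M_n(\mathbb{Q}) \mid A, B \in M_n(\mathbb{Q}),\ [A]=_2^n [B],\ \operatorname{rank} A=\operatorname{rank} B=n\}.$$ For a field $K$ and a positive definite symmetric matrix $Q$ of order $m$, the orthogonal group of $Q$ over $K$ is $$O_m(Q,K) = \{A \in \mathrm{GL}_m(K) \mid A^T Q A = Q\}.$$ *)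

(* Defs.v *)
From HB Require Import structures.
From mathcomp Require Import all_boot all_order all_algebra.
From mathcomp Require Import boolp classical_sets.

Set Implicit Arguments.
Unset Strict Implicit.
Unset Printing Implicit Defensive.

Import GRing.Theory.
Local Open Scope classical_set_scope.
Local Open Scope ring_scope.

(* The columns of A and B are two multisets of n points of Q^n with equal
   moments of every multidegree k of total degree between 1 and d. *)
Definition pte_eq (d n : nat) (A B : 'M[rat]_n) : Prop :=
  forall k : 'I_n -> nat, (1 <= \sum_(i < n) k i <= d)%N ->
    \sum_(j < n) \prod_(i < n) A i j ^+ k i =
    \sum_(j < n) \prod_(i < n) B i j ^+ k i.

Definition N2 (n : nat) : set 'M[rat]_n :=
  [set C | exists A B : 'M[rat]_n,
     [/\ pte_eq 2 A B, \rank A = n, \rank B = n & C = invmx A *m B]].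
Arguments N2 : clear implicits.

(* The definition makes sense, and gives a group, for every square matrix Q;
   symmetry and positive definiteness are therefore not required here. *)
Definition orthogonal_set (K : fieldType) (m : nat) (Q : 'M[K]_m) :
    set 'M[K]_m :=
  [set A | A \in unitmx /\ A^T *m Q *m A = Q].

Definition Qmx (n : nat) : 'M[rat]_n.-1 :=
  diag_mx (\row_(i < n.-1) ((i.+1 * i.+2)%N%:R / 2)).

Section N2Group.
Variable n : nat.
Implicit Types A B C : 'M[rat]_n.

Lemma prod_exp_delta (x : 'I_n -> rat) (k : 'I_n -> nat) a :
  \prod_(i < n) x i ^+ ((i == a) + k i) = x a * \prod_(i < n) x i ^+ k i.
Proof.
under eq_bigr => i _ do rewrite exprD.
rewrite big_split /=; congr (_ * _).
rewrite (bigD1 a) //= eqxx expr1 big1 ?mulr1 // => i /negbTE ->.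
by rewrite expr0.
Qed.

Lemma sum_delta (a : 'I_n) (k : 'I_n -> nat) :
  (\sum_(i < n) ((i == a) + k i) = (\sum_(i < n) k i).+1)%N.
Proof.
rewrite big_split /= (bigD1 a) //= eqxx big1 ?addn0 ?add1n // => i /negbTE ->.
by [].
Qed.

Lemma sum_succ (k : 'I_n -> nat) m : (\sum_(i < n) k i = m.+1)%N ->
  exists (a : 'I_n) (l : 'I_n -> nat),
    (\sum_(i < n) l i = m)%N /\ (forall i, k i = ((i == a) + l i)%N).
Proof.
move=> km; have [a ka] : exists a, (0 < k a)%N.
  apply/existsP; apply: contra_eqT km; rewrite negb_exists => /forallP k0.
  by rewrite big1 // => i _; move: (k0 i); rewrite lt0n negbK => /eqP.
pose l i := (k i - (i == a))%N.
have kl i : k i = ((i == a) + l i)%N.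
  by rewrite /l; case: eqP => [->|_]; rewrite ?subn0 // subnKC.
exists a, l; split=> //; move: km; under eq_bigr do rewrite kl.
by rewrite sum_delta => -[].
Qed.

Lemma mulmx_trE A a b : (A *m A^T) a b = \sum_j A a j * A b j.
Proof. by rewrite mxE; apply: eq_bigr => j _; rewrite mxE. Qed.

Lemma pte_eq2P A B : pte_eq 2 A B <->
  (forall a, \sum_j A a j = \sum_j B a j) /\ A *m A^T = B *m B^T.
Proof.
have prod0 (x : 'I_n -> rat) (k : 'I_n -> nat) :
    (forall i, k i = 0)%N -> \prod_(i < n) x i ^+ k i = 1.
  by move=> k0; rewrite big1 // => i _; rewrite k0.
split=> [AB|[AB1 AB2] k /andP[]].
  split=> [a|].
    have := AB (fun i => ((i == a) + 0)%N).
    rewrite sum_delta big1 // => /(_ isT).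
    under eq_bigr do rewrite prod_exp_delta prod0 // mulr1.
    by under [in X in _ = X -> _]eq_bigr do
      rewrite prod_exp_delta prod0 // mulr1.
  apply/matrixP => a b; rewrite !mulmx_trE.
  have := AB (fun i => ((i == a) + ((i == b) + 0))%N).
  rewrite !sum_delta big1 // => /(_ isT).
  under eq_bigr do rewrite !prod_exp_delta prod0 // mulr1.
  by under [in X in _ = X -> _]eq_bigr do
    rewrite !prod_exp_delta prod0 // mulr1.
case km: (\sum_(i < n) k i)%N => [|[|[|//]]] // _ _.
  have [a [l [/eqP]]] := sum_succ km; rewrite sum_nat_eq0 => /forallP l0 kl.
  have {}l0 i : l i = 0%N by apply/eqP/(implyP (l0 i)).
  have E (x : 'I_n -> rat) : \prod_(i < n) x i ^+ k i = x a.
    by under eq_bigr do rewrite kl; rewrite prod_exp_delta prod0 ?mulr1.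
  by under eq_bigr do rewrite E; under [RHS]eq_bigr do rewrite E.
have [a [l [lm kl]]] := sum_succ km.
have [b [h [/eqP]]] := sum_succ lm; rewrite sum_nat_eq0 => /forallP h0 lh.
have {}h0 i : h i = 0%N by apply/eqP/(implyP (h0 i)).
have E (x : 'I_n -> rat) : \prod_(i < n) x i ^+ k i = x a * x b.
  under eq_bigr do rewrite kl lh.
  by rewrite !prod_exp_delta prod0 ?mulr1.
under eq_bigr do rewrite E; under [RHS]eq_bigr do rewrite E.
by have /matrixP/(_ a b) := AB2; rewrite !mulmx_trE.
Qed.

Lemma row_sumE A a : (A *m const_mx 1 : 'cV_n) a 0 = \sum_j A a j.
Proof. by rewrite mxE; apply: eq_bigr => j _; rewrite mxE mulr1. Qed.

Lemma N2P C : N2 n C <->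
  C *m const_mx 1 = const_mx 1 :> 'cV[rat]_n /\ C *m C^T = 1%:M.
Proof.
split=> [[A [B [/pte_eq2P[AB1 AB2] rA rB ->]]]|[C1 CC]].
  have uA : A \in unitmx by rewrite -row_free_unit /row_free rA.
  have e1 : A *m const_mx 1 = B *m const_mx 1 :> 'cV_n.
    by apply/matrixP => a j; rewrite ord1 !row_sumE.
  split; first by rewrite -mulmxA -e1 mulKmx.
  rewrite trmx_mul mulmxA -(mulmxA _ B) -AB2 mulKmx //.
  by rewrite -trmx_mul mulVmx // trmx1.
have uC : C \in unitmx by case/mulmx1_unit: CC.
exists 1%:M, C; split.
- apply/pte_eq2P; split=> [a|]; last by rewrite trmx1 mulmx1 CC.
  by rewrite -!row_sumE C1 mul1mx.
- by rewrite mxrank1.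
- by apply/eqP; rewrite -[_ == _]/(row_free C) row_free_unit.
- by rewrite invmx1 mul1mx.
Qed.

Lemma N2_1 : (1%:M : 'M[rat]_n) \in N2 n.
Proof. by rewrite inE; apply/N2P; rewrite mul1mx trmx1 mulmx1. Qed.

Lemma N2_unit C : C \in N2 n -> C \in unitmx.
Proof. by rewrite inE => /N2P[_ /mulmx1_unit[]]. Qed.

Lemma N2_M C D : C \in N2 n -> D \in N2 n -> C *m D \in N2 n.
Proof.
rewrite !inE => /N2P[C1 CC] /N2P[D1 DD]; apply/N2P; split.
  by rewrite -mulmxA D1 C1.
by rewrite trmx_mul mulmxA -(mulmxA C) DD mulmx1 CC.
Qed.

Lemma N2_V C : C \in N2 n -> invmx C \in N2 n.
Proof.
move=> NC; have uC := N2_unit NC; move: NC; rewrite !inE => /N2P[C1 CC].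
apply/N2P; split; first by rewrite -{1}C1 mulKmx.
have -> : invmx C = C^T by rewrite -[RHS](mulKmx uC) CC mulmx1.
by rewrite trmxK; apply: mulmx1C.
Qed.

Definition N2_group : Type := set_type (N2 n).
HB.instance Definition _ := SubChoice.copy N2_group (set_type (N2 n)).

Definition N2_one : N2_group := exist (fun C => C \in N2 n) _ N2_1.
Definition N2_mul (x y : N2_group) : N2_group :=
  exist (fun C => C \in N2 n) _ (N2_M (valP x) (valP y)).
Definition N2_inv (x : N2_group) : N2_group := exist (fun C => C \in N2 n) _ (N2_V (valP x)).

Lemma N2_mulA : associative N2_mul.
Proof. by move=> x y z; apply: val_inj; rewrite /= mulmxA. Qed.
Lemma N2_mul1g : left_id N2_one N2_mul.
Proof. by move=> x; apply: val_inj; rewrite /= mul1mx. Qed.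
Lemma N2_mulg1 : right_id N2_one N2_mul.
Proof. by move=> x; apply: val_inj; rewrite /= mulmx1. Qed.
Lemma N2_mulVg : left_inverse N2_one N2_inv N2_mul.
Proof.
by move=> x; apply: val_inj; rewrite /= mulVmx // (N2_unit (valP x)).
Qed.
Lemma N2_mulgV : right_inverse N2_one N2_inv N2_mul.
Proof.
by move=> x; apply: val_inj; rewrite /= mulmxV // (N2_unit (valP x)).
Qed.
HB.instance Definition _ :=
  isGroup.Build N2_group N2_mulA N2_mul1g N2_mulg1 N2_mulVg N2_mulgV.

Lemma val_N2_mul (x y : N2_group) : val (x * y)%g = val x *m val y.
Proof. by []. Qed.

End N2Group.

Section OrthogonalGroup.
Variables (K : fieldType) (m : nat) (Q : 'M[K]_m).
Local Notation O := (orthogonal_set Q).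

Lemma orthogonal_1 : 1%:M \in O.
Proof. by rewrite inE; split; rewrite ?unitmx1 // trmx1 mul1mx mulmx1. Qed.

Lemma orthogonal_M A B : A \in O -> B \in O -> A *m B \in O.
Proof.
rewrite !inE => -[uA QA] [uB QB]; split; first by rewrite unitmx_mul uA.
by rewrite -[RHS]QB -{2}QA trmx_mul !mulmxA.
Qed.

Lemma orthogonal_V A : A \in O -> invmx A \in O.
Proof.
rewrite !inE => -[uA QA]; split; first by rewrite unitmx_inv.
by rewrite -{1}QA trmx_inv !mulmxA mulVmx ?unitmx_tr // mul1mx mulmxK.
Qed.

Definition orthogonal_group : Type := set_type O.
HB.instance Definition _ := SubChoice.copy orthogonal_group (set_type O).

Definition orthogonal_one : orthogonal_group := exist (fun A => A \in O) _ orthogonal_1.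
Definition orthogonal_mul (x y : orthogonal_group) : orthogonal_group :=
  exist (fun A => A \in O) _ (orthogonal_M (valP x) (valP y)).
Definition orthogonal_inv (x : orthogonal_group) : orthogonal_group :=
  exist (fun A => A \in O) _ (orthogonal_V (valP x)).

Lemma orthogonal_unit (x : orthogonal_group) : val x \in unitmx.
Proof. by have := valP x; rewrite inE => -[]. Qed.

Lemma orthogonal_mulA : associative orthogonal_mul.
Proof. by move=> x y z; apply: val_inj; rewrite /= mulmxA. Qed.
Lemma orthogonal_mul1g : left_id orthogonal_one orthogonal_mul.
Proof. by move=> x; apply: val_inj; rewrite /= mul1mx. Qed.
Lemma orthogonal_mulg1 : right_id orthogonal_one orthogonal_mul.
Proof. by move=> x; apply: val_inj; rewrite /= mulmx1. Qed.
Lemma orthogonal_mulVg : left_inverse orthogonal_one orthogonal_inv orthogonal_mul.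
Proof. by move=> x; apply: val_inj; rewrite /= mulVmx // orthogonal_unit. Qed.
Lemma orthogonal_mulgV : right_inverse orthogonal_one orthogonal_inv orthogonal_mul.
Proof. by move=> x; apply: val_inj; rewrite /= mulmxV // orthogonal_unit. Qed.
HB.instance Definition _ := isGroup.Build orthogonal_group
  orthogonal_mulA orthogonal_mul1g orthogonal_mulg1
  orthogonal_mulVg orthogonal_mulgV.

Lemma val_orthogonal_mul (x y : orthogonal_group) :
  val (x * y)%g = val x *m val y.
Proof. by []. Qed.

End OrthogonalGroup.

(* Main.v *)
(** A matrix of [N2 n] is exactly an orthogonal matrix fixing the all-ones
    vector [u], so it is determined by the isometry it induces on the hyperplane
    orthogonal to [u].  That hyperplane has the rational orthogonal basis
    [e_0 + ... + e_j - (j + 1) e_(j+1)], whose vectors have squared norms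
    [(j + 1)(j + 2)], so its Gram matrix is [2 Q].  Writing the induced isometry
    in this basis gives the isomorphism. *)
Require Import Defs.
From mathcomp Require Import all_boot all_algebra.
From HB Require Import structures.
From mathcomp Require Import boolp classical_sets.

Set Implicit Arguments.
Unset Strict Implicit.
Unset Printing Implicit Defensive.

Import GRing.Theory.
Local Open Scope ring_scope.

(** * Isometries fixing a vector and their restriction to its orthogonal hyperplane *)

Section HyperplaneIsometries.
Variables (K : fieldType) (m : nat).
Variables (u : 'cV[K]_m.+1) (V : 'M[K]_(m.+1, m)) (D : 'M[K]_m) (c : K).
Hypotheses (uV : u^T *m V = 0) (VV : V^T *m V = D) (uu : u^T *m u = c%:M).
Hypotheses (uD : D \in unitmx) (c0 : c != 0).
Implicit Types (C : 'M[K]_m.+1) (A : 'M[K]_m).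

(** Since [V^T *m V = D], the factor [invmx D *m V^T] is a left inverse of [V] that reads off
    coordinates in the basis [V]. *)
Definition restrict_mx C : 'M[K]_m := invmx D *m V^T *m C *m V.
(** Acts as [A] on the span of [V], in that basis, and as the identity on the line of [u]. *)
Definition extend_mx A : 'M[K]_m.+1 :=
  V *m A *m invmx D *m V^T + c^-1 *: (u *m u^T).

Let Vu : V^T *m u = 0.
Proof. by rewrite -[LHS]trmxK trmx_mul trmxK uV trmx0. Qed.

Let trD : D^T = D.
Proof. by rewrite -VV trmx_mul trmxK. Qed.

(** The two terms are the orthogonal projections onto the hyperplane and onto the line of [u]. *)
Lemma hyperplane_projection_mx :
  V *m invmx D *m V^T + c^-1 *: (u *m u^T) = 1%:M.
Proof.
pose W : 'M[K]_(1 + m) := row_mx u V.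
pose L : 'M[K]_(1 + m) := col_mx (c^-1 *: u^T) (invmx D *m V^T).
(* [L *m W] reduces to the given relations between [u] and [V]; both matrices are square, so
   [W *m L = 1%:M] follows. *)
have LW : L *m W = 1%:M.
  rewrite mul_col_row -!scalemxAl uu uV -!mulmxA Vu VV mulVmx // mulmx0.
  by rewrite scaler0 scale_scalar_mx mulVf // -scalar_mx_block.
have := mulmx1C LW; rewrite mul_row_col -scalemxAr addrC => <-.
by rewrite mulmxA.
Qed.

Lemma hyperplane_projectionK p (X : 'M[K]_(m.+1, p)) :
  u^T *m X = 0 -> V *m (invmx D *m (V^T *m X)) = X.
Proof.
move=> uX; rewrite !mulmxA; have := congr1 (mulmx^~ X) hyperplane_projection_mx.
by rewrite /= mulmxDl -scalemxAl -!mulmxA uX mulmx0 scaler0 addr0 mul1mx !mulmxA.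
Qed.

Section FixingNormal.
Variable C : 'M[K]_m.+1.
Hypotheses (Cu : C *m u = u) (CC : C *m C^T = 1%:M).

Let uC : u^T *m C = u^T.
Proof.
by rewrite -{1}Cu trmx_mul -mulmxA (mulmx1C CC) mulmx1.
Qed.

(** [C] preserves the hyperplane: [u^T *m C = u^T] makes the columns of [C *m V] orthogonal to
    [u]. *)
Lemma restrict_mxE : V *m restrict_mx C = C *m V.
Proof. by rewrite /restrict_mx -!mulmxA hyperplane_projectionK // mulmxA uC. Qed.

Lemma restrict_mxK : extend_mx (restrict_mx C) = C.
Proof.
rewrite /extend_mx restrict_mxE -[RHS]mulmx1 -hyperplane_projection_mx.
by rewrite mulmxDr -scalemxAr !mulmxA Cu.
Qed.

Lemma restrict_mx_isometry : (restrict_mx C)^T *m D *m restrict_mx C = D.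
Proof.
have : V *m restrict_mx C = C *m V := restrict_mxE.
move: (restrict_mx C) => A VA.
have -> : A^T *m D *m A = (V *m A)^T *m (V *m A).
  by rewrite -VV trmx_mul !mulmxA.
by rewrite VA trmx_mul -mulmxA (mulmxA C^T) (mulmx1C CC) mul1mx.
Qed.

End FixingNormal.

(** [C' *m V] can be replaced by [V *m restrict_mx C'], after which the product splits. *)
Lemma restrict_mxM C C' : C' *m u = u -> C' *m C'^T = 1%:M ->
  restrict_mx (C *m C') = restrict_mx C *m restrict_mx C'.
Proof.
move=> Cu CC; rewrite {2}/restrict_mx -!mulmxA restrict_mxE //.
by rewrite /restrict_mx !mulmxA.
Qed.

Lemma extend_mxK A : restrict_mx (extend_mx A) = A.
Proof.
rewrite /restrict_mx /extend_mx -!mulmxA mulmxDl -scalemxAl -!mulmxA uV VV.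
by rewrite !mulmx0 scaler0 addr0 mulVmx // mulmx1 (mulmxA V^T) VV mulKmx.
Qed.

Lemma extend_mx_fix A : extend_mx A *m u = u.
Proof.
rewrite /extend_mx mulmxDl -scalemxAl -!mulmxA Vu uu !mulmx0 add0r.
by rewrite mul_mx_scalar scalerA mulVf // scale1r.
Qed.

Lemma extend_mx_orthogonal A :
  A^T *m D *m A = D -> extend_mx A *m (extend_mx A)^T = 1%:M.
Proof.
(* The isometry condition says that [invmx D *m A^T *m D] is a left inverse of [A], hence also a
   right inverse. *)
move=> AD; have ADA : A *m (invmx D *m A^T) = invmx D.
  have: invmx D *m A^T *m D *m A = 1%:M by rewrite -!mulmxA (mulmxA A^T) AD mulVmx.
  by move/mulmx1C; rewrite mulmxA => /(canRL (mulmxK uD)); rewrite mul1mx.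
have -> : (extend_mx A)^T = V *m (invmx D *m (A^T *m V^T)) + c^-1 *: (u *m u^T).
  by rewrite /extend_mx linearD linearZ /= !trmx_mul !trmxK trmx_inv trD !mulmxA.
rewrite mulmxDr -scalemxAr (mulmxA _ u) extend_mx_fix /extend_mx mulmxDl -scalemxAl.
rewrite -!mulmxA (mulmxA u^T V) uV mul0mx mulmx0 scaler0 addr0.
rewrite (mulmxA V^T V) VV mulKVmx // (mulmxA (invmx D)) (mulmxA A) ADA.
by rewrite mulmxA hyperplane_projection_mx.
Qed.

End HyperplaneIsometries.

(** * An orthogonal basis of the sum-zero hyperplane *)

Section SumZeroBasis.
Variable m : nat.

(** Indexed by [nat], so that row and column indices compare without casts between ordinals. *)
Definition sum_zero_coef (i j : nat) : rat :=
  if (i <= j)%N then 1 else if i == j.+1 then - j.+1%:R else 0.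

Definition sum_zero_mx : 'M[rat]_(m.+1, m) :=
  \matrix_(i, j) sum_zero_coef i j.

(** Serves both the column sums and the squared norms; [j < m] ensures that row [j.+1] exists. *)
Lemma sum_step (R : pzRingType) (a b : R) (j : nat) : (j < m)%N ->
  \sum_(i < m.+1) (if (i <= j)%N then a else if i == j.+1 :> nat then b else 0) =
  a *+ j.+1 + b.
Proof.
move=> jm; pose F i := if (i <= j)%N then a else if i == j.+1 then b else 0.
rewrite -(big_mkord xpredT F) (big_cat_nat (n := j.+2)) //=.
rewrite [X in _ + X]big_nat_cond [X in _ + X]big1 ?addr0 => [|i].
  rewrite big_nat_recr //= {2}/F ltnn eqxx; congr (_ + _).
  rewrite big_mkord (eq_bigr (fun=> a)) ?sumr_const ?card_ord // => i _.
  by rewrite /F -ltnS ltn_ord.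
rewrite andbT => /andP[ji _]; rewrite /F leqNgt (ltnW ji) /=.
by rewrite gtn_eqF.
Qed.

Lemma sum_zero_coef_sum j : (j < m)%N -> \sum_(i < m.+1) sum_zero_coef i j = 0.
Proof. by move=> jm; rewrite sum_step // subrr. Qed.

(** Column [k] is constantly 1 on the support of column [j], so the inner product is the sum of
    column [j]. *)
Lemma sum_zero_coef_orth j k : (j < k)%N -> (k < m)%N ->
  \sum_(i < m.+1) sum_zero_coef i j * sum_zero_coef i k = 0.
Proof.
move=> jk km; apply: etrans (sum_zero_coef_sum (ltn_trans jk km)).
apply: eq_bigr => i _; rewrite /sum_zero_coef.
case: (leqP i j) => [ij|_]; first by rewrite (leq_trans ij (ltnW jk)) mulr1.
by case: eqP => [->|_]; rewrite ?jk ?mulr1 ?mul0r.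
Qed.

Lemma sum_zero_coef_norm j : (j < m)%N ->
  \sum_(i < m.+1) sum_zero_coef i j * sum_zero_coef i j = (j.+1 * j.+2)%:R.
Proof.
move=> jm; rewrite (eq_bigr (fun i : 'I_m.+1 => if (i <= j)%N then 1 else
    if i == j.+1 :> nat then j.+1%:R * j.+1%:R else 0)) => [|i _].
  by rewrite sum_step // natrM -(natr1 j.+1) mulrDr mulr1 addrC.
by rewrite /sum_zero_coef; do 2?case: ifP => _; rewrite ?mulr1 ?mulrNN ?mulr0.
Qed.

Lemma sum_zero_mx_ones : (const_mx 1 : 'cV_m.+1)^T *m sum_zero_mx = 0.
Proof.
apply/matrixP => i j; rewrite !mxE -[RHS](sum_zero_coef_sum (ltn_ord j)).
by apply: eq_bigr => k _; rewrite !mxE mul1r.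
Qed.

Lemma sum_zero_mx_gram : sum_zero_mx^T *m sum_zero_mx = 2 *: Qmx m.+1.
Proof.
apply/matrixP => j k; rewrite !mxE.
under eq_bigr do rewrite !mxE.
have [<-|jk] := eqVneq j k.
  by rewrite sum_zero_coef_norm // mulr1n mulrC divfK.
rewrite mulr0n mulr0; have [jk'|kj|/val_inj/eqP] := ltngtP j k.
- exact: sum_zero_coef_orth.
- by under eq_bigr do rewrite mulrC; apply: sum_zero_coef_orth.
- by rewrite (negbTE jk).
Qed.

End SumZeroBasis.

(** * The isomorphism between the two groups *)

Section Isomorphism.
Variable m : nat.
Local Notation u := (const_mx 1 : 'cV[rat]_m.+1).
Local Notation V := (sum_zero_mx m).
Local Notation D := (2 *: Qmx m.+1).

Let uu : u^T *m u = m.+1%:R%:M.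
Proof.
apply/matrixP => i j; rewrite !ord1 !mxE eqxx mulr1n.
by rewrite (eq_bigr (fun=> 1)) ?sumr_const ?card_ord // => k _; rewrite !mxE mulr1.
Qed.

Let uD : D \in unitmx.
Proof.
rewrite unitmxZ ?unitfE // unitmxE det_diag unitfE; apply/prodf_neq0 => i _.
by rewrite mxE mulf_neq0 // Num.Theory.pnatr_eq0 muln_eq0.
Qed.

Let c0 : m.+1%:R != 0 :> rat.
Proof. by rewrite Num.Theory.pnatr_eq0. Qed.

Let uV := sum_zero_mx_ones m.
Let VV := sum_zero_mx_gram m.

(** Scaling a form by a nonzero constant keeps its isometries, which absorbs the factor 2 of the
    Gram matrix. *)
Lemma orthogonal_Qmx_scaled (A : 'M[rat]_m) :
  A^T *m D *m A = D <-> A^T *m Qmx m.+1 *m A = Qmx m.+1.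
Proof.
rewrite -scalemxAr -scalemxAl; split=> [|->//].
by apply: scalerI.
Qed.

Lemma restrict_mx_orthogonal (x : N2_group m.+1) :
  restrict_mx V D (val x) \in orthogonal_set (Qmx m.+1).
Proof.
have := valP x; rewrite !inE => /N2P[xu xx].
have iso := restrict_mx_isometry uV VV uu uD c0 xu xx.
split; last by apply/orthogonal_Qmx_scaled.
(* Invertibility is read off [D], a unit that factors through the restricted matrix. *)
have := uD; rewrite -{1}iso unitmx_mul; by case/andP.
Qed.

Lemma extend_mx_N2 (y : orthogonal_group (Qmx m.+1)) :
  extend_mx u V D m.+1%:R (val y) \in N2 m.+1.
Proof.
have := valP y; rewrite !inE => -[_ /orthogonal_Qmx_scaled yD].
by apply/N2P; split; [apply: extend_mx_fix | apply: extend_mx_orthogonal].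
Qed.

Definition N2_to_orthogonal (x : N2_group m.+1) : orthogonal_group (Qmx m.+1) :=
  exist (fun A => A \in orthogonal_set (Qmx m.+1)) _ (restrict_mx_orthogonal x).

Definition orthogonal_to_N2 (y : orthogonal_group (Qmx m.+1)) : N2_group m.+1 :=
  exist (fun C => C \in N2 m.+1) _ (extend_mx_N2 y).

Lemma N2_to_orthogonalM :
  {morph N2_to_orthogonal : x y / (x * y)%g >-> (x * y)%g}.
Proof.
move=> x y; apply: val_inj; rewrite val_orthogonal_mul /=.
have := valP y; rewrite inE => /N2P[yu yy].
exact: restrict_mxM uV VV uu uD c0 _ _ yu yy.
Qed.

HB.instance Definition _ := isMultiplicative.Build
  (N2_group m.+1) (orthogonal_group (Qmx m.+1))
  N2_to_orthogonal N2_to_orthogonalM.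

Lemma N2_to_orthogonal_bij : bijective N2_to_orthogonal.
Proof.
exists orthogonal_to_N2 => [x|y]; apply: val_inj => /=.
  have := valP x; rewrite inE => /N2P[xu xx].
  exact: restrict_mxK uV VV uu uD c0 _ xu xx.
exact: extend_mxK uV VV uD _.
Qed.

End Isomorphism.

Theorem theorem1p6 (n : nat) (hn : (2 <= n)%N) :
  exists f : {multiplicative N2_group n -> orthogonal_group (Qmx n)},
    bijective f.
Proof.
(* Writing [n] as [m.+1] makes the hyperplane dimension [m] the order of [Qmx n]. *)
case: n hn => // m _; exists (@N2_to_orthogonal m).
exact: N2_to_orthogonal_bij.
Qed.
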